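(* Let $(X,\mathcal U)$ be a uniform space such that for every $U\in\mathcal U$ there are a bounded set $B\subset X$ and $n\in\mathbb N$ such that $X\setminus U^n[B]$ is uniformly isolated. Suppose further that there is a sequence $(U_n)_{n\in\mathbb N}\subset\mathcal U$ such that: (1) every infinite uniformly isolated set in $X$ contains an infinite set which is uniformly $U_n$-isolated for some $n\in\mathbb N$; (2) for every bounded set $B\subset X$ and every $U\in\mathcal U$ there are $n,m\in\mathbb N$ such that the set $I=U_n[B]\setminus U^m[B]$ is uniformly isolated and $U_n[I]\subset I$. Then there is a bounded set $F\subset X$ such that for each $U\in\mathcal U$ there is $n\in\mathbb N$ such that $X\setminus U^n[F]$ is uniformly isolated.
   Context: Uniform spaces are Hausdorff, given by their filters $\mathcal U$ of entourages; all $U\in\mathcal U$ considered are assumed open and symmetric. $\mathbb N$ denotes the positive integers. For $U\in\mathcal U$, $F\subset X$, $n\in\mathbb N$: $U^n=U\circ\cdots\circ U$ ($n$ times), $U[F]=\{x\in X:(x,y)\in U\text{ for some }y\in F\}$ and $U[x]=U[\{x\}]$. A set $B\subset X$ is (Bourbaki) bounded in $X$ if every real-valued uniformly continuous function on $X$ is bounded on $B$ (equivalently, for every $U\in\mathcal U$ there are $n\in\mathbb N$ and a finite $F\subset X$ with $B\subset U^n[F]$). A set $A\subset X$ is uniformly $U$-isolated, for $U\in\mathcal U$, if $U[x]=\{x\}$ for every $x\in A$; it is uniformly isolated if it is uniformly $U$-isolated for some $U\in\mathcal U$. *)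

(* Defs.v *)
From HB Require Import structures.
From mathcomp Require Import all_boot all_order all_algebra.
From mathcomp Require Import all_classical all_reals.
From mathcomp Require Import topology normedtype.

Set Implicit Arguments.
Unset Strict Implicit.
Unset Printing Implicit Defensive.

Import Order.TTheory GRing.Theory Num.Theory.
Import numFieldNormedType.Exports.

Local Open Scope classical_set_scope.
Local Open Scope ring_scope.
Local Open Scope relation_scope.

(* The entourages considered are the open symmetric ones; openness is for the
   product topology of X * X. *)
Definition osym_entourage (X : uniformType) (U : set (X * X)) : Prop :=
  [/\ entourage U, open U & U^-1 = U].

(* rel_pow U n.+1 is the (n+1)-fold composition of U with itself; rel_pow U 0
   is the diagonal, and only positive exponents are used below. *)
Definition rel_pow (X : Type) (U : set (X * X)) (n : nat) : set (X * X) :=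
  iter n (fun V => V \; U) diagonal.

Definition rel_nbhd (X : Type) (U : set (X * X)) (F : set X) : set X :=
  [set x | exists2 y, F y & U (x, y)].

Definition bourbaki_bounded (R : realType) (X : uniformType) (B : set X) : Prop :=
  forall f : X -> R, unif_continuous f -> bounded_set (f @` B).

Definition unif_isolated_at (X : Type) (U : set (X * X)) (A : set X) : Prop :=
  forall x, A x -> rel_nbhd U [set x] = [set x].

Definition unif_isolated (X : uniformType) (A : set X) : Prop :=
  exists2 U : set (X * X), osym_entourage U & unif_isolated_at U A.

(* Main.v *)
Require Import Defs.
From mathcomp Require Import all_boot all_order all_algebra.
From mathcomp Require Import all_classical all_reals.
From mathcomp Require Import topology normedtype interval_inference.
From mathcomp Require Import lra.

Set Implicit Arguments.
Unset Strict Implicit.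
Unset Printing Implicit Defensive.

Import Order.TTheory GRing.Theory Num.Theory.
Import numFieldNormedType.Exports.
Local Open Scope classical_set_scope.
Local Open Scope ring_scope.

(** In hypothesis h2 the set I = U_n[B] \ U^m[B] is in fact empty: a point of I
    is U_n-related to a point of B, which therefore lies in U_n[I], hence in I,
    although I is disjoint from B. So h2 says that, for every bounded B and every
    U, the set U_n[B] is included in U^m[B] for some n and m
    ([rel_nbhd_sub_closedD]).

    Write W^k[B] for the set of points joined to B by W-chains of length k. One
    builds decreasing entourages W_n inside U_{n+1}, bounded sets B_n, and sets
    C_n = W_n^{k_n}[B_n] whose complements are uniformly isolated, such that the
    complement of C_n is W_{n+1}-isolated and B_{n+1} is included in C_n. Since
    W_{n+1}-chains neither enter nor leave C_n, one may discard the points of a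
    bounded set that lie outside C_n, and the sets C_n decrease
    ([exists_filtration]). The set sought is the union F of the B_n.

    Boundedness of F follows from a criterion ([bounded_filtration]): G is
    bounded as soon as every G \ C_n is. If a uniformly continuous f were
    unbounded on G, a sequence in G along which |f| tends to infinity fast enough
    would be uniformly isolated by hB, so by h1 infinitely many of its terms would
    form a W_n-isolated set for some n. Those lying in C_n, being joined to B_n by
    W_n-chains, lie in B_n itself; so f would be bounded on all these terms,
    because it is bounded on B_n and on G \ C_n.

    Given U, let E be the set of points joined to F by a U-chain. Some C_n lies
    in E: otherwise for each n a W_{n+1}-chain inside C_n, from B_{n+1} to a point
    outside E, contains a step (y_n, z_n) leaving E; the y_n form a bounded set by
    the criterion, and h2 applied to this set puts some z_n in E. Finally take D
    bounded such that the complement of U^k[D] is uniformly isolated. The points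
    of D in E are joined to F by U-chains of bounded length ([bounded_level]), so
    that for some j the complement of U^{k+j}[F] is covered by the complements
    of U^k[D] and of C_n. The bound on the length comes from a uniformly
    continuous real function that measures the length of U-chains from F, built
    from a pseudometric subordinate to U. *)

(** * Chains *)

Lemma rel_nbhd_pow (X : Type) (U : set (X * X)) (n : nat) (F : set X) :
  rel_nbhd (rel_pow U n) F = iter n (rel_nbhd U) F.
Proof.
elim: n => [|n IHn].
  apply/seteqP; split=> x; last by exists x.
  by case=> y Fy; rewrite /rel_pow /= /diagonal /= => ->.
rewrite iterS -IHn; apply/seteqP; split=> x /=.
  by case=> y Fy [z Uxz Vzy]; exists z => //; exists y.
by case=> z [y Fy Vzy] Uxz; exists y => //; exists z.
Qed.

Lemma rel_nbhdS (X : Type) (U V : set (X * X)) (A B : set X) :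
  U `<=` V -> A `<=` B -> rel_nbhd U A `<=` rel_nbhd V B.
Proof. by move=> UV AB x [y /AB By /UV Vxy]; exists y. Qed.

Lemma iter_rel_nbhd_sub (X : Type) (U : set (X * X)) (n : nat) (A C : set X) :
  A `<=` C -> rel_nbhd U C `<=` C -> iter n (rel_nbhd U) A `<=` C.
Proof.
move=> AC UC; elim: n => //= n IHn.
by apply: subset_trans UC; apply: rel_nbhdS.
Qed.

Lemma iter_rel_nbhd_leq (X : uniformType) (U : set (X * X)) (m n : nat)
    (A : set X) : entourage U -> (m <= n)%N ->
  iter m (rel_nbhd U) A `<=` iter n (rel_nbhd U) A.
Proof.
move=> entU /subnK <-; elim: (n - m)%N => // k IHk x /IHk Ax.
by rewrite addSn iterS; exists x => //; exact: entourage_refl.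
Qed.

(** * Open symmetric entourages and isolated sets *)

Section OpenSymmetric.
Variable X : uniformType.
Implicit Types (U V : set (X * X)) (A B C : set X).

Lemma osym_sym U x y : osym_entourage U -> U (x, y) -> U (y, x).
Proof. by case=> _ _ UE Uxy; rewrite -UE. Qed.

Lemma osym_setI U V :
  osym_entourage U -> osym_entourage V -> osym_entourage (U `&` V).
Proof.
move=> oU oV; have [eU opU _] := oU; have [eV opV _] := oV.
split; [exact: filterI|exact: openI|].
by apply/seteqP; split=> -[x y] [/= Uxy Vxy]; split; apply: osym_sym.
Qed.

Lemma isolatedP U (oU : osym_entourage U) A :
  unif_isolated_at U A <-> forall x y, A x -> U (x, y) -> x = y.
Proof.
split=> [iA x y Ax Uxy|iA x Ax].
  suff : [set x] y by [].
  by rewrite -(iA _ Ax); exists x => //; exact: osym_sym.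
apply/seteqP; split=> y /=.
  by case=> _ /= -> /(osym_sym oU) /(iA _ _ Ax).
by move=> ->; exists x => //; apply: entourage_refl; case: oU.
Qed.

Lemma unif_isolatedS A B : A `<=` B -> unif_isolated B -> unif_isolated A.
Proof. by move=> AB [U oU iB]; exists U => // x /AB; exact: iB. Qed.

Lemma unif_isolatedU A B :
  unif_isolated A -> unif_isolated B -> unif_isolated (A `|` B).
Proof.
move=> [U oU /(isolatedP oU _) iA] [V oV /(isolatedP oV _) iB].
exists (U `&` V); first exact: osym_setI.
apply/isolatedP; first exact: osym_setI.
by move=> x y [Ax|Bx] [Uxy Vxy]; [exact: iA|exact: iB].
Qed.

(** No step of a U-chain enters or leaves a set whose complement is
    U-isolated. *)
Lemma isolatedC_closed U C : osym_entourage U ->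
  unif_isolated_at U (~` C) -> rel_nbhd U C `<=` C.
Proof.
move=> oU /(isolatedP oU _) iC x [y Cy Uxy]; apply: contrapT => nCx.
by apply: (nCx); rewrite (iC _ _ nCx Uxy).
Qed.

(** A chain that ends at an isolated point is constant. *)
Lemma iter_isolated U n A B : osym_entourage U -> unif_isolated_at U A ->
  A `&` iter n (rel_nbhd U) B `<=` B.
Proof.
move=> oU /(isolatedP oU _) iA; elim: n => [x []//|n IHn x [Ax [y By Uxy]]].
by apply: IHn; move: By; rewrite -(iA _ _ Ax Uxy).
Qed.

Lemma rel_nbhd_sub_closedD U A S : osym_entourage U -> A `<=` S ->
  rel_nbhd U (rel_nbhd U A `\` S) `<=` rel_nbhd U A `\` S ->
  rel_nbhd U A `<=` S.
Proof.
move=> oU AS clI x [y Ay Uxy]; apply: contrapT => nSx.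
have [_] : (rel_nbhd U A `\` S) y; last by apply; exact: AS.
by apply: clI; exists x; [split => //; exists y|exact: osym_sym].
Qed.

End OpenSymmetric.

(** * Bounded sets *)

Section Bounded.
Variables (R : realType) (X : uniformType).
Implicit Types (A B : set X).

Lemma bourbaki_boundedP B :
  bourbaki_bounded R B <->
  forall f : X -> R, unif_continuous f ->
    exists M : R, forall x, B x -> `|f x| <= M.
Proof.
split=> bB f cf.
  have [M _ HM] := pinfty_ex_gt (num_real 0) (bB f cf).
  by exists M => x Bx; apply: HM; exists x.
have [M HM] := bB f cf.
exists M; split=> [|M' /ltW MM' _ [x Bx <-]]; first exact: num_real.
exact: le_trans (HM _ Bx) MM'.
Qed.

Lemma bourbaki_boundedS A B :
  A `<=` B -> bourbaki_bounded R B -> bourbaki_bounded R A.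
Proof.
move=> AB /bourbaki_boundedP bB; apply/bourbaki_boundedP => f /bB[M HM].
by exists M => x /AB; exact: HM.
Qed.

Lemma bourbaki_boundedU A B :
  bourbaki_bounded R A -> bourbaki_bounded R B -> bourbaki_bounded R (A `|` B).
Proof.
move=> /bourbaki_boundedP bA /bourbaki_boundedP bB.
apply/bourbaki_boundedP => f cf.
have [M HM] := bA f cf; have [N HN] := bB f cf.
by exists (Num.max M N) => x [/HM|/HN] h; rewrite le_max h ?orbT.
Qed.

Lemma bourbaki_bounded0 : @bourbaki_bounded R X set0.
Proof. by apply/bourbaki_boundedP => f _; exists 0. Qed.

Lemma bourbaki_bounded1 x : bourbaki_bounded R [set x : X].
Proof. by apply/bourbaki_boundedP => f _; exists `|f x| => _ ->. Qed.

Lemma bourbaki_bounded_bigcup (B : nat -> set X) n :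
  (forall i, bourbaki_bounded R (B i)) ->
  bourbaki_bounded R (\bigcup_(i in `I_n) B i).
Proof.
move=> bB; elim: n => [|n IHn].
  by rewrite II0 bigcup_set0; exact: bourbaki_bounded0.
by rewrite IIS bigcup_setU bigcup_set1; exact: bourbaki_boundedU.
Qed.

Lemma unif_continuous_osym (f : X -> R) : unif_continuous f ->
  osym_entourage [set p | `|f p.1 - f p.2| < 1].
Proof.
move=> cf; split.
- apply: (cf [set p | `|p.1 - p.2| < 1]).
  exact: (entourage_ball R 1%:pos).
- have cfX : continuous f.
    move=> x A /nbhsP[V entV VA]; apply/nbhsP; exists [set p | V (f p.1, f p.2)].
      exact: cf.
    by move=> y /xsectionP Vxy; apply: VA; apply/xsectionP.
  apply: (@open_comp _ _ (fun p : X * X => `|f p.1 - f p.2|) [set r | r < 1]);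
    last exact: open_lt.
  move=> p _; apply: cvg_norm; apply: cvgB.
    by apply: (cvg_comp _ _ (@cvg_fst _ _ (nbhs p.1) (nbhs p.2) _)); exact: cfX.
  by apply: (cvg_comp _ _ (@cvg_snd _ _ (nbhs p.1) (nbhs p.2) _)); exact: cfX.
- by apply/seteqP; split=> -[x y] /=; rewrite distrC.
Qed.

Lemma bounded_iter (f : X -> R) (U : set (X * X)) n B (c : R) :
  (forall p, U p -> `|f p.1 - f p.2| <= c) ->
  unif_continuous f -> bourbaki_bounded R B ->
  exists M : R, forall x, iter n (rel_nbhd U) B x -> `|f x| <= M.
Proof.
move=> Uf cf /bourbaki_boundedP/(_ _ cf)[M HM].
elim: n => [|n [N HN]]; first by exists M.
exists (N + c) => x [y /HN fy /Uf /= Uxy].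
rewrite -[f x](subrK (f y)) addrC; apply: le_trans (ler_normD _ _) _.
exact: lerD.
Qed.

End Bounded.

(** A uniformly continuous pseudometric subordinate to an entourage, presented by
    the sets D e of pairs at distance less than e. *)
Lemma entourage_gauge (R : realType) (X : uniformType) (U : set (X * X)) :
  entourage U -> exists D : R -> set (X * X),
    [/\ forall e, 0 < e -> entourage (D e),
        forall e x y, D e (x, y) -> D e (y, x),
        forall e d x y z, D e (x, y) -> D d (y, z) -> D (e + d) (x, z) &
        D 1 `<=` U].
Proof.
move=> entU; pose G : pseudoMetricType R := gauge.type entU.
have : @entourage G U by exists 0%N => // -[x y] [].
rewrite -entourage_ballE => -[r /= r0 rU].
exists (fun e => [set p | @ball R G p.1 (r * e) p.2]); split.
- move=> e e0; apply: (@gauge.gauge_ent X U entU).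
  rewrite -[gauge.gauge _]/(@entourage G) -entourage_ballE.
  by exists (r * e) => //=; rewrite mulr_gt0.
- by move=> e x y /= /ball_sym.
- by move=> e d x y z /= xy yz; rewrite mulrDr; exact: ball_triangle xy yz.
- by move=> p /=; rewrite mulr1; exact: rU.
Qed.

(** The points of a bounded set that are joined to F by U-chains are joined to F
    by U-chains of bounded length.  The proof interpolates the length of a
    shortest U-chain from F by a uniformly continuous function: f y is the
    infimum of the n + e, with 0 < e <= 1, such that y is at distance less than e,
    for the pseudometric D, from a point joined to F by a U-chain of length n. *)
Lemma bounded_level (R : realType) (X : uniformType) (U : set (X * X))
    (B F : set X) :
  entourage U -> bourbaki_bounded R B -> exists j : nat,
    B `&` \bigcup_n iter n (rel_nbhd U) F `<=` iter j (rel_nbhd U) F.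
Proof.
move=> entU bB; have [D [entD symD triD DU]] := entourage_gauge R entU.
pose S n := iter n (rel_nbhd U) F.
pose L y := [set t : R | exists (n : nat) (e : R) (x : X),
  [/\ 0 < e, e <= 1, S n x, D e (y, x) & t = n%:R + e]].
pose f y := inf (L y).
have DleU e p : 0 < e -> e <= 1 -> D e p -> U p.
  case: p => x y e0; rewrite le_eqVlt => /predU1P[-> /DU //|e1 Dxy].
  apply: DU; rewrite -[1](subrK e) addrC; apply: triD Dxy _.
  by apply: entourage_refl; apply: entD; rewrite subr_gt0.
have L0 y : lbound (L y) 0.
  by move=> _ [n [e [x [e0 _ _ _ ->]]]]; rewrite addr_ge0// ltW.
have fL y t : L y t -> f y <= t by apply: ge_inf; exists 0.
have LE y : L y !=set0 <-> (\bigcup_n S n) y.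
  split=> [[_ [n [e [x [e0 e1 Sx /(DleU _ _ e0 e1) Uyx _]]]]]|[n _ Sy]].
    by exists n.+1 => //; exists x.
  exists (n%:R + 1), n, 1, y; split => //; apply: entourage_refl.
  exact: entD.
(* if d + e > 1, the chain is extended to y instead, which costs at most d
   more *)
have step d y z t : 0 < d -> d <= 1 -> D d (y, z) -> L y t ->
    exists2 s, L z s & s <= t + d + d.
  move=> d0 d1 Dyz [n [e [x [e0 e1 Sx Dyx ->]]]].
  have [ed1|ed1] := leP (d + e) 1.
    exists (n%:R + (d + e)); last lra.
    exists n, (d + e), x; split => //; first exact: addr_gt0.
    by apply: triD Dyx; exact: symD.
  exists (n.+1%:R + d); last by rewrite -natr1; lra.
  exists n.+1, d, y; split => //; last exact: symD.
  by exists x => //; exact: DleU Dyx.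
(* off the U-chain components of F, L is empty and f takes the value inf set0 *)
have lip d y z : 0 < d -> d <= 1 -> D d (y, z) -> f y - f z <= d + d.
  move=> d0 d1 Dyz; have Dzy := symD _ _ _ Dyz.
  have [[t Lz]|/set0P/negP/negPn/eqP Lz0] := pselect (L z !=set0); last first.
    suff -> : f y = f z by lra.
    rewrite /f Lz0; congr inf; apply/seteqP; split=> // t.
    move=> /(step d _ _ _ d0 d1 Dyz).
    by case=> s; rewrite Lz0.
  rewrite lerBlDr -lerBlDl; apply: lb_le_inf; first by exists t.
  move=> {Lz}t /(step d _ _ _ d0 d1 Dzy)[s /fL fs st]; lra.
have cf : unif_continuous f.
  move=> V; rewrite -entourage_ballE => -[r /= r0 rV].
  pose d := Num.min 1 (r / 3).
  have d0 : 0 < d by rewrite lt_min ltr01 divr_gt0.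
  have d1 : d <= 1 by rewrite ge_min lexx.
  have dr : d <= r / 3 by rewrite ge_min lexx orbT.
  apply: filterS (entD _ d0) => -[y z] Dyz; apply: rV; rewrite /ball /=.
  have := lip _ _ _ d0 d1 Dyz; have := lip _ _ _ d0 d1 (symD _ _ _ Dyz).
  by rewrite ltr_norml => ? ?; apply/andP; split; lra.
have [M HM] := (bourbaki_boundedP _ _).1 bB _ cf.
have [N MN] : exists N : nat, M < N%:R.
  by exists (Num.truncn M).+1; rewrite truncnS_gt.
exists N => y [/HM fyM /LE Ly].
have fyN : f y < N%:R by apply: le_lt_trans MN; exact: le_trans (ler_norm _) fyM.
have [_ [n [e [x [e0 e1 Sx Dyx ->]]]] neN] := inf_lt Ly fyN.
have nN : (n < N)%N by rewrite -(ltr_nat R); lra.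
by apply: (iter_rel_nbhd_leq entU nN); exists x => //; exact: DleU Dyx.
Qed.

(** * A decreasing sequence of sets with isolated complements *)

Section Filtration.
Variables (R : realType) (X : uniformType) (Us : nat -> set (X * X)).
Hypothesis hB : forall U : set (X * X), osym_entourage U ->
  exists (B : set X) (n : nat), [/\ bourbaki_bounded R B, (0 < n)%N &
    unif_isolated (~` iter n (rel_nbhd U) B)].
Hypothesis hUs : forall n : nat, (0 < n)%N -> osym_entourage (Us n).

(** The construction is recursive: W_{n+1} is taken inside an entourage isolating
    the complement of C_n, and B_{n+1} is the part in C_n of a bounded set that
    hB provides for W_{n+1}. *)
Lemma exists_filtration : exists (W : nat -> set (X * X)) (B C : nat -> set X),
  [/\ forall n, osym_entourage (W n) /\ W n `<=` Us n.+1,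
      forall n, W n.+1 `<=` W n,
      forall n, bourbaki_bounded R (B n),
      forall n, exists k, C n = iter k (rel_nbhd (W n)) (B n) &
      forall n, [/\ B n.+1 `<=` C n, unif_isolated (~` C n) &
                 unif_isolated_at (W n.+1) (~` C n)]].
Proof.
pose C (s : set (X * X) * set X * nat) := iter s.2 (rel_nbhd s.1.1) s.1.2.
pose inv n s := [/\ osym_entourage s.1.1, s.1.1 `<=` Us n.+1,
  bourbaki_bounded R s.1.2 & unif_isolated (~` C s)].
have [st0 inv0] : exists s, inv 0%N s.
  have [B [n [bB _ iB]]] := hB (hUs (ltnSn 0)).
  by exists (Us 1, B, n); split => //; exact: hUs.
pose next n s s' := inv n.+1 s' /\ [/\ s'.1.1 `<=` s.1.1, s'.1.2 `<=` C s &
  unif_isolated_at s'.1.1 (~` C s)].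
have step (p : nat * (set (X * X) * set X * nat)) :
    exists s', inv p.1 p.2 -> next p.1 p.2 s'.
  case: p => n [[W B] k] /=.
  have [[/= oW WU bB [V oV iV]]|ninv] := pselect (inv n (W, B, k)); last first.
    by exists st0 => /ninv.
  pose W' := V `&` W `&` Us n.+2.
  have oW' : osym_entourage W'.
    by apply: osym_setI; [exact: osym_setI|exact: hUs].
  have iW' : unif_isolated_at W' (~` C (W, B, k)).
    apply/(isolatedP oW') => x y Cx [[Vxy _] _].
    by move/(isolatedP oV): iV => /(_ x y Cx Vxy).
  have [B' [k' [bB' _ iB']]] := hB oW'.
  exists (W', B' `&` C (W, B, k), k') => _; split; last first.
    by split => //= p [[_ +] _].
  split => //=; first by move=> p [].
    exact: bourbaki_boundedS bB'.
  have iC : unif_isolated (~` C (W, B, k)) by exists V.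
  apply: unif_isolatedS (unif_isolatedU iB' iC).
  (* a W'-chain from B' to a point of C (W, B, k) stays in C (W, B, k), so it
     starts in B' `&` C (W, B, k) *)
  move=> y nCy; apply: contrapT => /not_orP[/contrapT By /contrapT Cy].
  apply: nCy; rewrite /C /=; move: y By Cy.
  elim: (k') => [//|j IHj] y [z Bz Wyz] Cy; exists z => //; apply: IHj => //.
  by apply: (isolatedC_closed oW' iW'); exists y => //; exact: osym_sym.
have [nx nxP] := choice step.
pose st := fix st n := if n is m.+1 then nx (m, st m) else st0.
have stI n : inv n (st n).
  by elim: n => //= n IHn; have [] := nxP (n, st n) IHn.
have stN n : next n (st n) (st n.+1) by exact: (nxP (n, st n) (stI n)).
exists (fun n => (st n).1.1), (fun n => (st n).1.2), (fun n => C (st n)).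
split.
- by move=> n; have [] := stI n.
- by move=> n; have [_ []] := stN n.
- by move=> n; have [] := stI n.
- by move=> n; exists (st n).2.
- by move=> n; have [_ []] := stN n; have [] := stI n.
Qed.

Hypothesis h1 : forall A : set X, infinite_set A -> unif_isolated A ->
  exists (A' : set X) (n : nat),
    [/\ A' `<=` A, infinite_set A', (0 < n)%N & unif_isolated_at (Us n) A'].

(** A set is bounded if it is bounded off each C n. *)
Lemma bounded_filtration (W : nat -> set (X * X)) (B C : nat -> set X) :
  (forall n, osym_entourage (W n) /\ W n `<=` Us n.+1) ->
  (forall n, bourbaki_bounded R (B n)) ->
  (forall n, exists k, C n = iter k (rel_nbhd (W n)) (B n)) ->
  forall G : set X, (forall n, bourbaki_bounded R (G `\` C n)) ->
  bourbaki_bounded R G.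
Proof.
move=> oW bB CE G bG; apply/bourbaki_boundedP => f cf; apply: contrapT.
move=> /forallNP unb.
have [D [k [bD _ iD]]] := hB (unif_continuous_osym cf).
have [M HM] : exists M : R, forall x,
    iter k (rel_nbhd [set p | `|f p.1 - f p.2| < 1]) D x -> `|f x| <= M.
  by apply: bounded_iter bD => // p /ltW; exact.
have /choice[x xP] (j : nat) : exists x, G x /\ M + j%:R < `|f x|.
  have /existsNP[x /not_implyP[Gx /negP]] := unb (M + j%:R).
  by rewrite -ltNge => ?; exists x.
(* f is unbounded on every infinite set of terms of the sequence x *)
have xfin (A : set X) (N : R) : A `<=` range x ->
    (forall y, A y -> `|f y| <= N) -> finite_set A.
  move=> Ax AN; apply: (@sub_finite_set _ _ (x @` `I_(Num.truncn (N - M)).+1)).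
    move=> y Ay; have [j _ xjy] := Ax y Ay; exists j => //=.
    have := (xP j).2; rewrite xjy -(ltr_nat R) => fy.
    apply: lt_trans (truncnS_gt (N - M)); have := AN _ Ay; lra.
  by apply: finite_image; exact: finite_II.
(* on a finite range, |f| would be bounded by the sum of its values *)
have infx : infinite_set (range x).
  move=> /finite_seqP[s sE].
  pose N := \sum_(y <- s) `|f y|.
  have Nf y : range x y -> `|f y| <= N.
    rewrite sE => /= ys; rewrite /N (big_rem y ys) /=.
    by rewrite lerDl sumr_ge0.
  have := Nf _ (ex_intro2 _ _ (Num.truncn (N - M)).+1 I erefl).
  have := (xP (Num.truncn (N - M)).+1).2; have := truncnS_gt (N - M); lra.
have isox : unif_isolated (range x).
  apply: unif_isolatedS iD => _ [j _ <-] /HM.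
  have := (xP j).2; have := ler0n R j; lra.
have [A [n' [Ax infA]]] := h1 infx isox; case: n' => // n _ iA.
have [oWn WUn] := oW n.
have iAn : unif_isolated_at (W n) (A `&` C n).
  apply/(isolatedP oWn) => y z [Ay _] /WUn Uyz.
  by move/(isolatedP (hUs (ltn0Sn n))): iA => /(_ y z Ay Uyz).
have AB : A `&` C n `<=` B n.
  have [j CnE] := CE n; move=> y [Ay Cy].
  by apply: (iter_isolated oWn iAn (n := j)); rewrite -CnE.
have AG : A `\` C n `<=` G `\` C n.
  by move=> y [/Ax[j _ <-] nC]; split => //; exact: (xP j).1.
have [N HN] := (bourbaki_boundedP _ _).1 (bourbaki_boundedU (bB n) (bG n)) _ cf.
apply: infA; apply: (xfin _ N Ax) => y Ay; apply: HN.
have [Cy|nCy] := pselect (C n y); first by left; exact: AB.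
by right; exact: AG.
Qed.

End Filtration.

(** * The bounded set F *)

Theorem proposition2p7 (R : realType) (X : uniformType)
  (hX : hausdorff_space X)
  (hB : forall U : set (X * X), osym_entourage U ->
    exists (B : set X) (n : nat),
      [/\ bourbaki_bounded R B, (0 < n)%N &
          unif_isolated (~` rel_nbhd (rel_pow U n) B)])
  (Us : nat -> set (X * X))
  (hUs : forall n : nat, (0 < n)%N -> osym_entourage (Us n))
  (h1 : forall A : set X, infinite_set A -> unif_isolated A ->
    exists (A' : set X) (n : nat),
      [/\ A' `<=` A, infinite_set A', (0 < n)%N & unif_isolated_at (Us n) A'])
  (h2 : forall (B : set X) (U : set (X * X)),
    bourbaki_bounded R B -> osym_entourage U ->
    exists n m : nat,
      let I := rel_nbhd (Us n) B `\` rel_nbhd (rel_pow U m) B in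
      [/\ (0 < n)%N, (0 < m)%N, unif_isolated I &
          rel_nbhd (Us n) I `<=` I]) :
  exists2 F : set X, bourbaki_bounded R F &
    forall U : set (X * X), osym_entourage U ->
      exists2 n : nat, (0 < n)%N &
        unif_isolated (~` rel_nbhd (rel_pow U n) F).
Proof.
have hB' U : osym_entourage U -> exists (B : set X) (n : nat),
    [/\ bourbaki_bounded R B, (0 < n)%N &
        unif_isolated (~` iter n (rel_nbhd U) B)].
  by move=> /hB[B [n]]; rewrite rel_nbhd_pow; exists B, n.
have [W [B [C [oW Wdec bB CE CP]]]] := exists_filtration hB' hUs.
have bdd := bounded_filtration hB' hUs h1 oW bB CE.
have Wcl n : rel_nbhd (W n.+1) (C n) `<=` C n.
  by have [_ _] := CP n; apply: isolatedC_closed; have [] := oW n.+1.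
have Cdec n j : (n <= j)%N -> C j `<=` C n.
  move=> /subnK <-; elim: (j - n)%N => //= i IHi.
  apply: subset_trans IHi; rewrite addSn; have [k ->] := CE (i + n).+1.
  by apply: iter_rel_nbhd_sub => //; have [] := CP (i + n)%N.
pose F := \bigcup_n B n.
exists F.
  apply: bdd => n; apply: bourbaki_boundedS (bourbaki_bounded_bigcup n.+1 bB).
  move=> x [[j _ Bx] nCx]; exists j => //=; rewrite ltnS leqNgt; apply/negP.
  case: j Bx => // j Bx nj; apply: nCx; apply: (Cdec n j) => //.
  by have [+ _ _] := CP j; exact.
move=> U oU; have [entU _ _] := oU.
pose E := \bigcup_n iter n (rel_nbhd U) F.
have FE : F `<=` E by move=> x Fx; exists 0%N.
have UE : rel_nbhd U E `<=` E.
  by move=> x [y [n _ Ey] Uxy]; exists n.+1 => //; exists y.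
(* otherwise choose p n = (y, z) with y in C n, such that (z, y) is a step of a
   W n.+1-chain at which this chain leaves E *)
have [n CnE] : exists n, C n `<=` E.
  apply: contrapT => /forallNP nCE.
  have /choice[p pP] (n : nat) : exists p : X * X,
      [/\ C n p.1, E p.1, ~ E p.2 & W n.+1 (p.2, p.1)].
    apply: contrapT => /forallNP np; apply: (nCE n.+1).
    have [BC _ _] := CP n; have [k ->] := CE n.+1.
    apply: (subset_trans (B := C n `&` E)); last by move=> x [].
    apply: iter_rel_nbhd_sub.
      by move=> x Bx; split; [exact: BC|apply: FE; exists n.+1].
    move=> z [y [Cy Ey] Wzy]; split; first by apply: Wcl; exists y.
    by apply: contrapT => nEz; exact: (np (y, z)).
  pose G := range (fun n => (p n).1).
  have bG : bourbaki_bounded R G.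
    apply: bdd => n.
    have := bourbaki_bounded_bigcup n (fun j => @bourbaki_bounded1 R X (p j).1).
    apply: bourbaki_boundedS.
    move=> _ [[j _ <-] nC]; exists j => //=; rewrite ltnNge; apply/negP => nj.
    by apply: nC; apply: (Cdec n j nj); have [] := pP j.
  have [n [m []]] := h2 _ _ bG oU; case: n => // n _ m0 _.
  rewrite rel_nbhd_pow => clI; have [Cp Ep nEp Wp] := pP n.
  have [oWn WU] := oW n.
  have GE : iter m (rel_nbhd U) G `<=` E.
    by apply: iter_rel_nbhd_sub => // _ [j _ <-]; have [] := pP j.
  apply/nEp/GE/(rel_nbhd_sub_closedD (hUs n.+1 (ltn0Sn n)) _ clI).
    exact: (iter_rel_nbhd_leq entU (leq0n m)).
  by exists (p n).1; [exists n|exact/WU/Wdec].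
have [D [k [bD k0 iD]]] := hB' _ oU.
have [j Dj] := bounded_level F entU bD.
exists (k + j)%N; first by rewrite addn_gt0 k0.
rewrite rel_nbhd_pow; have [_ iC _] := CP n.
apply: unif_isolatedS (unif_isolatedU iD iC).
move=> y nFy; apply: contrapT => /not_orP[/contrapT Dy /contrapT /CnE Ey].
(* a U-chain from D to a point of E starts in E *)
apply: nFy; rewrite iterD; move: y Dy Ey.
elim: (k) => [|i IHi] y; first by move=> Dy Ey; apply: Dj.
move=> [z Dz Uyz] Ey; exists z => //; apply: IHi => //.
by apply: UE; exists y => //; exact: osym_sym Uyz.
Qed.
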